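(* Let $\Omega\subset\mathbb{R}^3$ be a compact domain (the closure of a nonempty bounded connected open set) with Lipschitz boundary, consisting of a homogeneous isotropic linear elastic material with Young's modulus $E$ and Poisson's ratio $\nu$. Then there exists a symmetric rank-2 tensor field $\epsilon$ of class $C^2$ on $\Omega$ (an elastic strain field), not identically zero, such that $\epsilon_{22}=\epsilon_{33}=0$ at every point of $\Omega$ and such that the corresponding stress $\sigma=C:\epsilon$ satisfies $\mathrm{Div}(\sigma)=0$ on $\Omega$ and $\sigma\cdot n=0$ on $\partial\Omega$.
   Context: Here $n$ is the outward unit normal on $\partial\Omega$ (defined almost everywhere), $[\mathrm{Div}(\sigma)]_j=\sum_i\partial_i\sigma_{ij}$ and $[\sigma\cdot n]_i=\sum_j\sigma_{ij}n_j$. $C$ is the constant positive definite isotropic elasticity tensor with Young's modulus $E$ and Poisson's ratio $\nu$ (so $E>0$ and $-1<\nu<1/2$); the relation $\sigma=C:\epsilon$ is Hooke's law, equivalently $\epsilon_{ij}=\frac{1}{E}\big((1+\nu)\sigma_{ij}-\nu\,\mathrm{tr}(\sigma)\,\delta_{ij}\big)$; in particular $\epsilon_{22}=\frac1E(\sigma_{22}-\nu(\sigma_{11}+\sigma_{33}))$ and $\epsilon_{33}=\frac1E(\sigma_{33}-\nu(\sigma_{11}+\sigma_{22}))$. *)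

(* Defs.v *)
From HB Require Import structures.
From mathcomp Require Import all_boot all_order all_algebra.
From mathcomp Require Import ring lra.
From mathcomp Require Import all_classical all_reals all_analysis.

Set Implicit Arguments.
Unset Strict Implicit.
Unset Printing Implicit Defensive.

Import Order.TTheory GRing.Theory Num.Theory.
Import numFieldNormedType.Exports.

Local Open Scope classical_set_scope.
Local Open Scope ring_scope.

(* The classical indices 1, 2, 3 are the ordinals 0, 1, 2 of 'I_3. *)
Definition ix1 : 'I_3 := @Ordinal 3 0 isT.
Definition ix2 : 'I_3 := @Ordinal 3 1 isT.
Definition ix3 : 'I_3 := @Ordinal 3 2 isT.

Section Calculus.
Context {R : realType}.

Definition basis_vec (n : nat) (i : 'I_n) : 'cV[R]_n := delta_mx i 0.

Definition partial (n : nat) (i : 'I_n) (f : 'cV[R]_n -> R) : 'cV[R]_n -> R :=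
  fun x => 'D_(basis_vec i) f x.

Definition gradient (n : nat) (f : 'cV[R]_n -> R) (x : 'cV[R]_n) : 'cV[R]_n :=
  \col_i partial i f x.

(* Meant for open U: the values of f near a point of U determine its partial
   derivatives there. *)
Fixpoint class_C (k n : nat) (U : set 'cV[R]_n) (f : 'cV[R]_n -> R) : Prop :=
  (forall x, U x -> {for x, continuous f}) /\
  match k with
  | 0%N => True
  | k'.+1 => forall i : 'I_n,
      (forall x, U x -> derivable f x (basis_vec i)) /\
      class_C k' U (partial i f)
  end.

(* A tensor field is of class C^k on a closed set A when its components are
   C^k on some open neighbourhood of A. *)
Definition tensor_class_C (k : nat) (A : set 'cV[R]_3)
    (T : 'cV[R]_3 -> 'M[R]_3) : Prop :=
  exists U : set 'cV[R]_3,
    [/\ open U, A `<=` U & forall i j, class_C k U (fun x => T x i j)].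

Definition Div (T : 'cV[R]_3 -> 'M[R]_3) (x : 'cV[R]_3) : 'cV[R]_3 :=
  \col_j \sum_i partial i (fun y => T y i j) x.

End Calculus.

Section Domains.
Context {R : realType}.

Definition compact_domain (Om : set 'cV[R]_3) : Prop :=
  exists D : set 'cV[R]_3,
    [/\ D !=set0, bounded_set D, open D, connected D & Om = closure D].

Definition bdry (Om : set 'cV[R]_3) : set 'cV[R]_3 := closure Om `\` interior Om.

(* Near x, and in the orthonormal coordinates z = Q (y - x), the set Om is the
   epigraph z_3 >= g (z_1, z_2) of the Lipschitz function g. *)
Definition lipschitz_chart (Om : set 'cV[R]_3) (x : 'cV[R]_3)
    (Q : 'M[R]_3) (g : 'cV[R]_2 -> R) : Prop :=
  [/\ Q *m Q^T = 1%:M,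
      lipschitz g &
      \forall y \near x,
        let z : 'cV[R]_(2 + 1) := Q *m (y - x) in
        Om y <-> g (usubmx z) <= dsubmx z 0 0].

Definition lipschitz_boundary (Om : set 'cV[R]_3) : Prop :=
  forall x, bdry Om x -> exists Q g, lipschitz_chart Om x Q g.

(* The normal exists at the boundary points x at which a graph function g is
   differentiable (almost all of them, by Rademacher's theorem). As Om lies
   above the graph, the outward direction is (grad g, -1) in the coordinates z
   of the chart, and Q^T takes it back to the original coordinates. *)
Definition outward_unit_normal (Om : set 'cV[R]_3) (x n : 'cV[R]_3) : Prop :=
  exists Q g,
    [/\ lipschitz_chart Om x Q g,
        differentiable g 0 &
        let N : 'cV[R]_(2 + 1) := col_mx (gradient g 0) (- 1%:M) in
        n = (Num.sqrt (1 + \sum_i gradient g 0 i 0 ^+ 2))^-1 *: (Q^T *m N)].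

End Domains.

Section Elasticity.
Context {R : realType}.

Definition lame_lambda (E nu : R) : R := E * nu / ((1 + nu) * (1 - 2 * nu)).
Definition lame_mu (E nu : R) : R := E / (2 * (1 + nu)).

Definition kron (i j : 'I_3) : R := (i == j)%:R.

Definition elasticity_tensor (E nu : R) (i j k l : 'I_3) : R :=
  lame_lambda E nu * (kron i j * kron k l) +
  lame_mu E nu * (kron i k * kron j l + kron i l * kron j k).

Definition double_contraction (C : 'I_3 -> 'I_3 -> 'I_3 -> 'I_3 -> R)
    (e : 'M[R]_3) : 'M[R]_3 :=
  \matrix_(i, j) \sum_k \sum_l C i j k l * e k l.

Lemma double_contraction_elasticity (E nu : R) (e : 'M[R]_3) : e^T = e ->
  double_contraction (elasticity_tensor E nu) e =
  (lame_lambda E nu * \tr e)%:M + (2 * lame_mu E nu) *: e.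
Proof.
move=> sym_e; apply/matrixP => i j; rewrite !mxE.
have kronE (f : 'I_3 -> R) i' : \sum_k kron i' k * f k = f i'.
  rewrite (bigD1 i')//= /kron eqxx mul1r big1 ?addr0// => k kNi.
  by rewrite eq_sym (negbTE kNi) mul0r.
have -> : \sum_k \sum_l elasticity_tensor E nu i j k l * e k l =
    lame_lambda E nu * kron i j * (\sum_k \sum_l kron k l * e k l) +
    lame_mu E nu * (\sum_k kron i k * (\sum_l kron j l * e k l)) +
    lame_mu E nu * (\sum_k kron j k * (\sum_l kron i l * e k l)).
  rewrite !mulr_sumr -!big_split; apply: eq_bigr => k _ /=.
  rewrite !mulr_sumr -!big_split; apply: eq_bigr => l _ /=.
  by rewrite /elasticity_tensor; ring.
have -> : \sum_k \sum_l kron k l * e k l = \tr e.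
  by apply: eq_bigr => k _; rewrite kronE.
rewrite !kronE.
have -> : e j i = e i j by rewrite -[in LHS]sym_e mxE.
by rewrite /kron -mulr_natr; ring.
Qed.

Lemma hooke_strain (E nu : R) (e : 'M[R]_3) : 0 < E -> -1 < nu -> nu < 1 / 2 ->
  e^T = e ->
  let s := double_contraction (elasticity_tensor E nu) e in
  e = E^-1 *: ((1 + nu) *: s - (nu * \tr s)%:M).
Proof.
move=> E0 nu1 nu2 sym_e s.
have EN0 : E != 0 by rewrite gt_eqF.
have nu1N0 : 1 + nu != 0 by rewrite gt_eqF//; lra.
have nu2N0 : 1 - 2 * nu != 0 by rewrite gt_eqF//; lra.
have -> : s = _ := double_contraction_elasticity E nu sym_e.
rewrite mxtraceD mxtraceZ mxtrace_scalar.
apply/matrixP => i j; rewrite !mxE /lame_lambda /lame_mu.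
by case: eqP => _; rewrite ?mulr1n ?mulr0n; field; rewrite ?EN0 ?nu1N0 ?nu2N0.
Qed.

End Elasticity.

(* Main.v *)
Require Import Defs.
From mathcomp Require Import all_boot all_order all_algebra.
From mathcomp Require Import ring lra.
From mathcomp Require Import all_classical all_reals all_analysis.

Set Implicit Arguments.
Unset Strict Implicit.
Unset Printing Implicit Defensive.

Import Order.TTheory GRing.Theory Num.Theory.
Import numFieldNormedType.Exports.

Local Open Scope classical_set_scope.
Local Open Scope ring_scope.

(** Under Hooke's law, the condition eps_22 = eps_33 = 0 makes the stress depend
    on the four functions eps_11, eps_12, eps_13, eps_23 only, with
    sigma_11 = (l + m) eps_11, sigma_22 = sigma_33 = l eps_11 and
    sigma_ij = m eps_ij for i <> j, where l = lambda and m = 2 mu. Equilibrium is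
    then a system of three first-order equations with constant coefficients for
    four unknowns, with symbol

      (l + m) x1   m x2   m x3    0
           l x2    m x1    0     m x3
           l x3     0     m x1   m x2

    The maximal minors of this matrix with alternating signs, divided by their
    common factor m^2, are four cubic forms in x1, x2, x3, and the vector that they
    form is in the kernel. Read as third-order differential operators, they send every scalar potential phi of class C^5 to a strain of
    class C^2 that has eps_22 = eps_33 = 0 and is in equilibrium
    ([strain_op], [div_stress_op]).

    So it suffices to take phi not zero with support in a small cube inside the
    open set whose closure is the body: the strain and the stress then vanish on
    the boundary, whatever the normal is. The potential used is a product
    b_1(x_1) b_2(x_2) b_3(x_3) of one-variable bumps
    b_j(t) = max(0, r^2 - (t - c_j)^2)^6. For such a product each partial
    derivative is the product of one-variable derivatives, determined by the
    number of times each index occurs, so that partial derivatives commute by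
    construction. Finally eps_11 = - 2 m b_1'(x_1) b_2'(x_2) b_3'(x_3) is not
    zero, because m > 0 and b_j' vanishes only at the centre inside the cube. *)

(** * One-variable bumps with finitely many derivatives *)

Definition pos_pow {R : realType} (m : nat) (t : R) : R := Num.max 0 t ^+ m.

Lemma pos_pow0 {R : realType} m (t : R) : t <= 0 -> pos_pow m.+1 t = 0.
Proof. by move=> t0; rewrite /pos_pow max_l// expr0n. Qed.

Lemma pos_powSS {R : realType} m (t : R) :
  pos_pow m.+2 t = pos_pow m.+1 t * t.
Proof.
have [t0|t0] := leP t 0; first by rewrite !pos_pow0// mul0r.
by rewrite /pos_pow max_r ?ltW// [LHS]exprSr.
Qed.

Lemma continuous_pos_pow {R : realType} m : continuous (@pos_pow R m).
Proof.
move=> t; apply: (@continuous_comp _ _ _ (Num.max (0 : R)) (@GRing.exp R ^~ m)).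
  by apply: (@continuous_max _ _ (cst 0) id) => //; exact: cst_continuous.
exact: exprn_continuous.
Qed.

(** At the origin the difference quotient of the power m + 2 is the power m + 1,
    which is continuous and vanishes there. *)
Lemma is_derive_pos_pow {R : realType} m (t : R) :
  is_derive t 1 (pos_pow m.+2) (m.+2%:R * pos_pow m.+1 t).
Proof.
have [t0|t0|->] := ltgtP t 0.
- rewrite pos_pow0 ?ltW// mulr0.
  apply: (near_eq_is_derive _ (is_derive_cst (0 : R) t 1)).
  near=> u; rewrite pos_pow0// ltW//.
  by near: u; exact: lt_nbhsl.
- have -> : m.+2%:R * pos_pow m.+1 t = ('X^(m.+2))^`().[t].
    by rewrite derivXn hornerMn hornerXn mulr_natl /pos_pow max_r ?ltW.
  apply: (near_eq_is_derive _ (is_derive_poly 'X^(m.+2) t)).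
  near=> u; rewrite hornerXn /pos_pow max_r// ltW//.
  by near: u; exact: lt_nbhsr.
- have cv : h^-1 *: ((pos_pow m.+2 \o shift 0) (h *: 1) - pos_pow m.+2 0)
      @[h --> (0 : R)^'] --> (0 : R).
    rewrite -[X in _ --> X](@pos_pow0 R m 0)//.
    apply: cvg_trans (@cvg_within_filter _ _ _ _ _ _ _ (@continuous_pos_pow R m.+1 0)).
    apply: near_eq_cvg; near=> h.
    rewrite (pos_pow0 m.+1)// subr0/= addr0 /GRing.scale/= mulr1 pos_powSS.
    rewrite mulrCA mulVf ?mulr1//.
    by near: h; exact: nbhs_dnbhs_neq.
  rewrite pos_pow0// mulr0; apply: DeriveDef; last exact: cvg_lim.
  by apply/cvg_ex; exists 0.
Unshelve. all: by end_near. Qed.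

(** The functions g 0, ..., g N are the successive derivatives of the function g 0
    of class C^N; g k is unconstrained for k > N. *)
Definition derivative_tower {R : realType} (N : nat) (g : nat -> R -> R) :=
  (forall k (t : R), (k < N)%N -> is_derive t 1 (g k) (g k.+1 t)) /\
  (forall k, (k <= N)%N -> continuous (g k)).

Section Bump.
Context {R : realType} (N : nat) (w : {poly R}).

(** The k-th derivative of max(0, w)^(N + 1), for k <= N, is
    max(0, w)^(N + 1 - k) times this polynomial. *)
Fixpoint bump_cofactor (k : nat) : {poly R} :=
  if k is k'.+1 then
    (N.+1 - k')%:R *: (w^`() * bump_cofactor k') + w * (bump_cofactor k')^`()
  else 1.

Definition bump (k : nat) (t : R) : R :=
  pos_pow (N.+1 - k) w.[t] * (bump_cofactor k).[t].

Lemma bump_tower : derivative_tower N bump.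
Proof.
split=> [k t kN|k kN t]; last first.
  apply: cvgM; last exact: continuous_horner.
  apply: (@continuous_comp _ _ _ (horner w)); first exact: continuous_horner.
  exact: continuous_pos_pow.
have [e eE] : exists e, (N - k = e.+1)%N.
  by exists (N - k).-1; rewrite prednK// subn_gt0.
have E2 : (N.+1 - k = e.+2)%N by rewrite subSn ?eE// ltnW.
have E1 : (N.+1 - k.+1 = e.+1)%N by rewrite subSS.
(* At least the square of max(0, w) is left, so the product and chain rules
   apply. *)
have -> : bump k = (pos_pow e.+2 \o horner w) * horner (bump_cofactor k).
  by apply/funext => u; rewrite /bump E2.
have dpos := is_derive_pos_pow e w.[t].
apply: is_derive_eq.
rewrite /bump E1 /= E2 pos_powSS !hornerE /GRing.scale/=.
ring.
Qed.

Lemma bump_eq0 k t : (k <= N)%N -> w.[t] <= 0 -> bump k t = 0.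
Proof. by move=> kN w0; rewrite /bump subSn// pos_pow0// mul0r. Qed.

Lemma bump1_neq0 t : 0 < w.[t] -> w^`().[t] != 0 -> bump 1 t != 0.
Proof.
move=> w0 dw0; rewrite /bump /= derivC mulr0 addr0 mulr1 subn0 hornerZ.
by rewrite /pos_pow max_r ?ltW// !mulf_neq0// ?expf_neq0 ?gt_eqF// pnatr_eq0.
Qed.

End Bump.

(** * Partial derivatives of products of one-variable functions *)

Lemma is_derive_line {R : realType} (V W : normedModType R) (f : V -> W) x v df :
  is_derive (0 : R) 1 (fun h => f (h *: v + x)) df -> is_derive x v f df.
Proof.
have E : (fun h : R => h^-1 *: (((fun h => f (h *: v + x)) \o shift 0) (h *: 1)
    - f (0 *: v + x))) = (fun h => h^-1 *: ((f \o shift x) (h *: v) - f x)).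
  by apply/funext => h; rewrite /= addr0 scale0r add0r /GRing.scale/= mulr1.
move=> [+ <-]; rewrite /derivable E => dv.
by apply: DeriveDef => //; rewrite /derive E.
Qed.

Section MixedDerivatives.
Context {R : realType} (n : nat) (g : 'I_n -> nat -> R -> R).

(** The partial derivative of the product of the g j 0 (x_j) along the indices
    listed in s: each g j is differentiated as often as j occurs in s. *)
Definition mixed (s : seq 'I_n) (x : 'cV[R]_n) : R :=
  \prod_j g j (count_mem j s) (x j 0).

(** The list p encodes the differential operator with constant coefficients that
    is the sum of the c.1 times the derivatives along c.2; it is applied to the
    product of the g j 0. *)
Definition diff_op (p : seq (R * seq 'I_n)) (x : 'cV[R]_n) : R :=
  \sum_(c <- p) c.1 * mixed c.2 x.

Definition partial_op (i : 'I_n) (p : seq (R * seq 'I_n)) :=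
  [seq (c.1, i :: c.2) | c <- p].

Definition scale_op (a : R) (p : seq (R * seq 'I_n)) :=
  [seq (a * c.1, c.2) | c <- p].

Lemma diff_op_scale a p x : diff_op (scale_op a p) x = a * diff_op p x.
Proof.
by rewrite /diff_op big_map mulr_sumr; apply: eq_bigr => c _; rewrite mulrA.
Qed.

Lemma diff_op_cat p q x : diff_op (p ++ q) x = diff_op p x + diff_op q x.
Proof. exact: big_cat. Qed.

End MixedDerivatives.

Section Smoothness.
Context {R : realType} (n N : nat) (g : 'I_n -> nat -> R -> R)
  (gN : forall j, derivative_tower N (g j)).
Local Notation mixed := (mixed g).
Local Notation diff_op := (diff_op g).

(** Along a line of direction i, only the factor of index i varies. *)
Lemma is_derive_mixed i s x : (size s < N)%N ->
  is_derive x (basis_vec i) (mixed s) (mixed (i :: s) x).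
Proof.
move=> sN; apply: is_derive_line.
pose C := \prod_(j | j != i) g j (count_mem j s) (x j 0).
have -> : (fun h => mixed s (h *: basis_vec i + x)) =
    C \*: (fun h => g i (count_mem i s) (h + x i 0)).
  apply/funext => h; rewrite /mixed (bigD1 i)//= mulrC; congr (_ * _).
    apply: eq_bigr => j ji; rewrite !mxE (negbTE ji)/=.
    by rewrite mulr0 add0r.
  by rewrite !mxE !eqxx mulr1.
have -> : mixed (i :: s) x = C *: g i (count_mem i s).+1 (x i 0).
  rewrite /mixed (bigD1 i)//= eqxx mulrC; congr (_ * _).
  by apply: eq_bigr => j ji; rewrite eq_sym (negbTE ji).
apply: is_deriveZ.
have dg : is_derive (shift (x i 0) 0) 1 (g i (count_mem i s))
    (g i (count_mem i s).+1 (x i 0)).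
  rewrite /= add0r; apply: (gN i).1.
  exact: leq_ltn_trans (count_size _ _) sN.
have ds := is_derive_shift (0 : R) 1 (x i 0).
by have := is_derive1_comp dg ds; rewrite mulr1.
Qed.

Lemma is_derive_diff_op i p x : all (fun c => (size c.2 < N)%N) p ->
  is_derive x (basis_vec i) (diff_op p) (diff_op (partial_op i p) x).
Proof.
elim: p => [_|c p IHp /= /andP[cN pN]].
  rewrite /diff_op/= big_nil.
  have -> : (fun x => \sum_(c <- [::]) c.1 * mixed c.2 x) = cst (0 : R).
    by apply/funext => y; rewrite big_nil.
  exact: is_derive_cst.
have -> : diff_op (c :: p) = (c.1 \*: mixed c.2) + diff_op p.
  by apply/funext => y; rewrite /diff_op big_cons.
rewrite /diff_op /partial_op/= big_cons/=.
have dc := @is_derive_mixed i c.2 x cN.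
have dp := IHp pN.
exact: is_deriveD.
Qed.

Lemma continuous_mixed s : (size s <= N)%N -> continuous (mixed s).
Proof.
move=> sN; apply: continuous_big; first exact: mul_continuous.
move=> j _ x; apply: (@continuous_comp _ _ _ (fun y : 'cV[R]_n => y j 0)).
  exact: coord_continuous.
by apply: (gN j).2; exact: leq_trans (count_size _ _) sN.
Qed.

Lemma continuous_diff_op p : all (fun c => (size c.2 <= N)%N) p ->
  continuous (diff_op p).
Proof.
elim: p => [_|c p IHp /= /andP[cN pN]].
  have -> : diff_op [::] = cst 0 by apply/funext => y; rewrite /diff_op big_nil.
  exact: cst_continuous.
have -> : diff_op (c :: p) = cst c.1 * mixed c.2 + diff_op p.
  by apply/funext => y; rewrite /diff_op big_cons.
move=> x; apply: continuousD; last exact: IHp.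
by apply: continuousM; [exact: cst_continuous|exact: continuous_mixed].
Qed.

(** Each partial derivative lengthens the index lists by one, so an operator of
    order N - k leaves k derivatives available. *)
Lemma class_C_diff_op k U p : all (fun c => (size c.2 + k <= N)%N) p ->
  class_C k U (diff_op p).
Proof.
elim: k p => [|k IHk] p pN /=.
  split=> // x _; apply: continuous_diff_op.
  by apply: sub_all pN => c; rewrite addn0.
split=> [x _|i].
  apply: continuous_diff_op.
  by apply: sub_all pN => c; apply: leq_trans; rewrite leq_addr.
have dp x : is_derive x (basis_vec i) (diff_op p) (diff_op (partial_op i p) x).
  apply: is_derive_diff_op.
  apply: sub_all pN => c; apply: leq_trans.
  by rewrite addnS ltnS leq_addr.
split=> [x _|]; first exact: ex_derive.
have -> : partial i (diff_op p) = diff_op (partial_op i p).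
  by apply/funext => x; rewrite /partial derive_val.
apply: IHk; rewrite all_map; apply: sub_all pN => c /=.
by rewrite addnS.
Qed.

Lemma partial_diff_op i p x : all (fun c => (size c.2 < N)%N) p ->
  partial i (diff_op p) x = diff_op (partial_op i p) x.
Proof.
by move=> pN; have dp := is_derive_diff_op i x pN; rewrite /partial derive_val.
Qed.

End Smoothness.

(** * Strains in equilibrium with a scalar potential *)

Lemma ord3P (P : 'I_3 -> Prop) : P ix1 -> P ix2 -> P ix3 -> forall i, P i.
Proof.
move=> P1 P2 P3 [[|[|[|//]]] i3].
- by have -> : Ordinal i3 = ix1 by exact: val_inj.
- by have -> : Ordinal i3 = ix2 by exact: val_inj.
- by have -> : Ordinal i3 = ix3 by exact: val_inj.
Qed.

Lemma sum_ord3 (V : nmodType) (F : 'I_3 -> V) :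
  \sum_i F i = F ix1 + F ix2 + F ix3.
Proof.
rewrite !big_ord_recl big_ord0 addr0 addrA; congr (F _ + F _ + F _);
  exact: val_inj.
Qed.

Lemma prod_ord3 (V : comPzRingType) (F : 'I_3 -> V) :
  \prod_i F i = F ix1 * F ix2 * F ix3.
Proof.
rewrite !big_ord_recl big_ord0 mulr1 mulrA; congr (F _ * F _ * F _);
  exact: val_inj.
Qed.

Section Strain.
Context {R : realType} (l m : R).

(** The cubic forms in the kernel of the equilibrium symbol; a monomial in x1, x2,
    x3 is the list of the indices of its factors. *)
Definition strain_op (i j : 'I_3) : seq (R * seq 'I_3) :=
  match val i, val j with
  | 0%N, 0%N => [:: (- (2 * m), [:: ix1; ix2; ix3])]
  | 0%N, 1%N | 1%N, 0%N =>
      [:: (l + m, [:: ix1; ix1; ix3]);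
          (l, [:: ix2; ix2; ix3]); (- l, [:: ix3; ix3; ix3])]
  | 0%N, 2%N | 2%N, 0%N =>
      [:: (l + m, [:: ix1; ix1; ix2]);
          (- l, [:: ix2; ix2; ix2]); (l, [:: ix2; ix3; ix3])]
  | 1%N, 2%N | 2%N, 1%N =>
      [:: (- (l + m), [:: ix1; ix1; ix1]);
          (l, [:: ix1; ix2; ix2]); (l, [:: ix1; ix3; ix3])]
  | _, _ => [::]
  end.

(** Hooke's law sigma = l tr(eps) + m eps; the trace is eps_11. *)
Definition stress_op (i j : 'I_3) : seq (R * seq 'I_3) :=
  (if i == j then scale_op l (strain_op ix1 ix1) else [::]) ++
  scale_op m (strain_op i j).

Lemma strain_op_sym i j : strain_op i j = strain_op j i.
Proof. by case: i j => [[|[|[|i]]] hi] [[|[|[|j]]] hj]. Qed.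

Lemma size_strain_op i j : all (fun c => size c.2 == 3%N) (strain_op i j).
Proof. by case: i j => [[|[|[|i]]] hi] [[|[|[|j]]] hj]. Qed.

Lemma size_stress_op i j : all (fun c => size c.2 == 3%N) (stress_op i j).
Proof.
rewrite all_cat; apply/andP; split; last by rewrite all_map size_strain_op.
by case: ifP => // _; rewrite all_map size_strain_op.
Qed.

(** After the derivatives are written by the multiplicities of their indices,
    each equation is the polynomial identity saying that the cubic forms lie in
    the kernel of the symbol. *)
Lemma div_stress_op (g : 'I_3 -> nat -> R -> R) j x :
  \sum_i diff_op g (partial_op i (stress_op i j)) x = 0.
Proof.
have [e12 e13 e23] : [/\ (ix1 == ix2) = false, (ix1 == ix3) = false &
  (ix2 == ix3) = false] by [].
have [e21 e31 e32] : [/\ (ix2 == ix1) = false, (ix3 == ix1) = false &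
  (ix3 == ix2) = false] by [].
rewrite sum_ord3.
elim/ord3P: j;
  rewrite /stress_op ?eqxx ?e12 ?e13 ?e23 ?e21 ?e31 ?e32 /diff_op /=;
  rewrite !big_cons !big_nil /= /mixed !prod_ord3 /=;
  rewrite ?eqxx ?e12 ?e13 ?e23 ?e21 ?e31 ?e32 /=; ring.
Qed.

End Strain.

Definition strain_field {R : realType} (l m : R) (g : 'I_3 -> nat -> R -> R)
    (x : 'cV[R]_3) : 'M[R]_3 :=
  \matrix_(i, j) diff_op g (strain_op l m i j) x.

Lemma strain_field_sym {R : realType} l m g (x : 'cV[R]_3) :
  (strain_field l m g x)^T = strain_field l m g x.
Proof. by apply/matrixP => i j; rewrite !mxE strain_op_sym. Qed.

Lemma stress_strain_field {R : realType} (E nu : R) g (x : 'cV[R]_3) i j :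
  let l := lame_lambda E nu in
  let m := 2 * lame_mu E nu in
  double_contraction (elasticity_tensor E nu) (strain_field l m g x) i j =
  diff_op g (stress_op l m i j) x.
Proof.
move=> l m.
rewrite double_contraction_elasticity ?strain_field_sym// !mxE.
rewrite diff_op_cat diff_op_scale -/l -/m; congr (_ + _).
have -> : \tr (strain_field l m g x) = diff_op g (strain_op l m ix1 ix1) x.
  by rewrite /mxtrace sum_ord3 !mxE /diff_op /= big_nil !addr0.
case: eqP => _; first by rewrite mulr1n diff_op_scale.
by rewrite mulr0n /diff_op big_nil.
Qed.

(** * Potentials supported in a cube *)

Lemma outside_ball {R : realType} n (c x : 'cV[R]_n) (r : R) : 0 < r ->
  ~ ball c r x -> exists j, r <= `|c j 0 - x j 0|.
Proof.
move=> r0; apply: contra_notP => /forallNP out; split=> // i j.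
by rewrite (ord1 j) /ball/= ltNge; apply/negP; exact: out.
Qed.

(** The norm of column vectors is the maximum norm, so the balls are cubes and a
    product of such bumps is supported in the closure of ball c r. *)
Definition cube_bump {R : realType} N n (c : 'cV[R]_n) (r : R) (j : 'I_n) :
    nat -> R -> R :=
  bump N ((r ^+ 2)%:P - ('X - (c j 0)%:P) ^+ 2).

Lemma mixed_cube_bump_eq0 {R : realType} N n (c : 'cV[R]_n) (r : R) s x :
  0 < r -> (size s <= N)%N -> ~ ball c r x -> mixed (cube_bump N c r) s x = 0.
Proof.
move=> r0 sN /(outside_ball r0)[j rj].
rewrite /mixed (bigD1 j)//= /cube_bump bump_eq0 ?mul0r//.
  exact: leq_trans (count_size _ _) sN.
rewrite !hornerE subr_le0 -[leRHS](real_normK (num_real _)) distrC.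
by rewrite ler_sqr// ?nnegrE// ltW.
Qed.

(** The point with all coordinates at distance r / 2 from the centre is inside the
    cube, and the derivative of each factor vanishes only at the centre. *)
Lemma mixed_cube_bump_neq0 {R : realType} N n (c : 'cV[R]_n) (r : R) s :
  0 < r -> (forall j, count_mem j s = 1%N) ->
  mixed (cube_bump N c r) s (c + const_mx (r / 2)) != 0.
Proof.
move=> r0 s1; apply/prodf_neq0 => j _; rewrite s1 /cube_bump !mxE.
apply: bump1_neq0.
  rewrite !hornerE addrAC subrr add0r.
  have : 0 < r ^+ 2 by rewrite exprn_gt0.
  rewrite expr_div_n; lra.
rewrite expr2 derivB derivC derivM derivXsubC mul1r mulr1.
rewrite !(hornerD, hornerN, hornerX, hornerC) sub0r oppr_eq0 gt_eqF//.
lra.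
Qed.

(** * Existence of the strain field *)

Theorem mainTheorem1 (R : realType) (Om : set 'cV[R]_3) (E nu : R)
    (hOm : compact_domain Om) (hLip : lipschitz_boundary Om)
    (hE : 0 < E) (hnu1 : -1 < nu) (hnu2 : nu < 1 / 2) :
  exists eps : 'cV[R]_3 -> 'M[R]_3,
    let sigma := fun x => double_contraction (elasticity_tensor E nu) (eps x) in
    [/\ tensor_class_C 2 Om eps,
        forall x, Om x -> (eps x)^T = eps x &
        exists2 x, Om x & eps x != 0] /\
    [/\ forall x, Om x -> eps x ix2 ix2 = 0 /\ eps x ix3 ix3 = 0,
        forall x, Om x -> Div sigma x = 0 &
        forall x n, bdry Om x -> outward_unit_normal Om x n ->
          sigma x *m n = 0].
Proof.
have [D [[c Dc] _ oD _ ->{hLip Om hOm}]] := hOm.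
have [r /= r0 crD] : exists2 r : R, 0 < r & ball c r `<=` D.
  by have /nbhs_ballP[r] := open_nbhs_nbhs (conj oD Dc); exists r.
set l := lame_lambda E nu; set m := 2 * lame_mu E nu.
have m0 : 0 < m.
  by rewrite mulr_gt0// divr_gt0// mulr_gt0//; lra.
(* Third-order operators leave two of the five derivatives. *)
pose g := cube_bump 5 c r.
have gN j : derivative_tower 5 (g j) by exact: bump_tower.
exists (strain_field l m g).
set sigma := fun x => double_contraction (elasticity_tensor E nu) _.
have sigmaE i j x : sigma x i j = diff_op g (stress_op l m i j) x.
  exact: stress_strain_field.
split; split.
- exists setT; split=> //; first exact: openT.
  move=> i j.
  have -> : (fun x => strain_field l m g x i j) = diff_op g (strain_op l m i j).
    by apply/funext => x; rewrite mxE.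
  apply: (class_C_diff_op gN).
  by apply: sub_all (size_strain_op l m i j) => q /eqP ->.
- by move=> x _; exact: strain_field_sym.
- exists (c + const_mx (r / 2)).
    apply/subset_closure/crD; split=> // i j.
    rewrite /ball/= !mxE opprD addrA subrr sub0r normrN gtr0_norm.
      by rewrite gtr_pMr//; lra.
    by rewrite divr_gt0.
  apply/eqP => /matrixP /(_ ix1 ix1).
  rewrite !mxE /diff_op /= big_seq1/=; apply/eqP.
  rewrite mulf_neq0//; first by rewrite oppr_eq0 gt_eqF// mulr_gt0.
  by apply: mixed_cube_bump_neq0 => //; elim/ord3P.
- by move=> x _; rewrite !mxE /diff_op/= big_nil.
- move=> x _; apply/matrixP => j k; rewrite !mxE.
  rewrite -[RHS](div_stress_op l m g j x); apply: eq_bigr => i _.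
  have -> : (fun y => sigma y i j) = diff_op g (stress_op l m i j).
    by apply/funext => y; exact: sigmaE.
  apply: (partial_diff_op gN).
  by apply: sub_all (size_stress_op l m i j) => q /eqP ->.
- move=> x n [_ xOm] _.
  suff sigma0 : sigma x = 0 by rewrite -/(sigma x) sigma0 mul0mx.
  apply/matrixP => i j.
  rewrite sigmaE mxE /diff_op.
  apply: big1_seq => q /=.
  move=> /(allP (size_stress_op l m i j))/eqP q3.
  rewrite (mixed_cube_bump_eq0 r0) ?q3 ?mulr0//.
  (* A point of the cube is interior to the closure of D. *)
  apply: contra_not xOm => bx.
  apply: filterS (open_nbhs_nbhs (conj oD (crD _ bx))).
  exact: subset_closure.
Qed.
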